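(* Let $\mathcal V$ be a quantale. A functor $F\colon\mathsf{Set}\to\mathsf{Set}$ has a separating class of $\mathcal V$-valued monotone predicate liftings if and only if there is a lax extension $\widehat F$ of $F$ to $\mathcal V\text{-}\mathsf{Rel}$ such that, for all sets $X$, the $\mathcal V$-category $(FX,\widehat F1_X)$ is separated.
   Context: A quantale $\mathcal V$ is a complete lattice with a commutative monoid structure $(\otimes,k)$ such that each $u\otimes-$ preserves suprema. A $\mathcal V$-relation $r\colon X\nrightarrow Y$ is a map $X\times Y\to\mathcal V$. For $r\colon X\nrightarrow Y$, $s\colon Y\nrightarrow Z$, the composite is $(s\cdot r)(x,z)=\bigvee_{y}r(x,y)\otimes s(y,z)$; $1_X$ has value $k$ on the diagonal and $\bot$ elsewhere; $\mathcal V\text{-}\mathsf{Rel}$ is the category of sets and $\mathcal V$-relations. $\mathcal V$-relations are ordered pointwise; $r^\circ(y,x)=r(x,y)$ is the converse. A function $f\colon X\to Y$ is regarded as the $\mathcal V$-relation with value $k$ on the graph of $f$ and $\bot$ elsewhere. A lax extension of $F$ to $\mathcal V\text{-}\mathsf{Rel}$ is an assignment $(r\colon X\nrightarrow Y)\mapsto(\widehat Fr\colon FX\nrightarrow FY)$ such that (L1) $r\le r'$ implies $\widehat Fr\le\widehat Fr'$; (L2) $\widehat Fs\cdot\widehat Fr\le\widehat F(s\cdot r)$; (L3) $Ff\le\widehat Ff$ and $(Ff)^\circ\le\widehat F(f^\circ)$ for all functions $f$. A $\mathcal V$-category $(X,a)$ is a set $X$ with $a\colon X\nrightarrow X$ satisfying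 $1_X\le a$ and $a\cdot a\le a$ (for a lax extension, $(FX,\widehat F1_X)$ is always one); it is separated if $k\le a(x,y)$ and $k\le a(y,x)$ imply $x=y$. For a cardinal $\kappa$, a $\kappa$-ary ($\mathcal V$-valued) predicate lifting for $F$ is a natural transformation $\mu\colon\mathsf{Set}(-,\mathcal V^\kappa)\to\mathsf{Set}(F-,\mathcal V)$ of functors $\mathsf{Set}^{\mathrm{op}}\to\mathsf{Set}$. It is monotone if each $\mu_X$ is monotone for the pointwise orders. A class $M$ of predicate liftings (of possibly varying arities $\kappa$) is separating if for every set $X$ the maps $\overline\mu_X\colon FX\to\mathsf{Set}(\mathsf{Set}(X,\mathcal V^\kappa),\mathcal V)$, $\overline\mu_X(\mathfrak x)(g)=\mu_X(g)(\mathfrak x)$, $\mu\in M$, are jointly injective. *)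

(* Defs.v *)
From HB Require Import structures.
From mathcomp Require Import all_boot all_order.
From mathcomp Require Import boolp classical_sets.

Set Implicit Arguments.
Unset Strict Implicit.
Unset Printing Implicit Defensive.

Import Order.TTheory.

Local Open Scope classical_set_scope.
Local Open Scope order_scope.

(* The objects of the category of sets are the types of one fixed universe,   *)
(* so that V^kappa, FX and the arities kappa all live in the same category.   *)
Definition SET := Type.

(* Arbitrary suprema make the underlying poset a complete lattice.  The       *)
(* choiceType structure carried by a porderType is no restriction, since      *)
(* every type has one by the classical axioms of boolp.                       *)
HB.mixin Record POrder_isQuantale d (V : Type) of Order.POrder d V := {
  qsup : set V -> V ;
  qsupP : forall A : set V, supremums A (qsup A) ;
  qunit : V ;
  qtens : V -> V -> V ;
  qtensA : associative qtens ;
  qtensC : commutative qtens ;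
  qtens1l : left_id qunit qtens ;
  qtens_sup : forall (u : V) (A : set V),
    qtens u (qsup A) = qsup [set qtens u v | v in A]
}.

#[short(type="quantaleType")]
HB.structure Definition Quantale d :=
  { V of Order.POrder d V & POrder_isQuantale d V }.

Section VRelations.
Context {d : Order.disp_t} {V : quantaleType d}.
Implicit Types X Y Z : SET.

Definition qbot : V := qsup set0.

Lemma qsup_ub (A : set V) v : A v -> v <= qsup A.
Proof. by case: (qsupP A) => + _; exact. Qed.

Lemma qsup_le (A : set V) v : (forall u, A u -> u <= v) -> qsup A <= v.
Proof. by case: (qsupP A) => _; exact. Qed.

Lemma qbot_le (v : V) : qbot <= v.
Proof. exact: qsup_le. Qed.

Definition vrel X Y : SET := X -> Y -> V.

Definition vrel_le X Y (r s : vrel X Y) : Prop := forall x y, r x y <= s x y.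

(* [vrel_comp s r] is s . r, i.e. first r and then s. *)
Definition vrel_comp X Y Z (s : vrel Y Z) (r : vrel X Y) : vrel X Z :=
  fun x z => qsup [set qtens (r x y) (s y z) | y in [set: Y]].

Definition vrel_id X : vrel X X :=
  fun x y => if `[< x = y >] then qunit else qbot.

Definition vrel_conv X Y (r : vrel X Y) : vrel Y X := fun y x => r x y.

Definition vrel_graph X Y (f : X -> Y) : vrel X Y :=
  fun x y => if `[< f x = y >] then qunit else qbot.

End VRelations.

Arguments vrel {d} V X Y.
Arguments vrel_id {d} V X.
Arguments vrel_graph {d} V {X Y} f.

Record vcategory d (V : quantaleType d) := VCategory {
  vcat_obj : SET ;
  vcat_hom : vrel V vcat_obj vcat_obj ;
  vcat_refl : vrel_le (vrel_id V vcat_obj) vcat_hom ;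
  vcat_trans : vrel_le (vrel_comp vcat_hom vcat_hom) vcat_hom
}.

Definition separated_vcat d (V : quantaleType d) (C : vcategory V) : Prop :=
  forall x y : vcat_obj C,
    (qunit : V) <= vcat_hom x y -> (qunit : V) <= vcat_hom y x -> x = y.

Record set_functor := SetFunctor {
  fobj :> SET -> SET ;
  fmap : forall X Y : SET, (X -> Y) -> fobj X -> fobj Y ;
  fmap_id : forall X : SET, fmap (@idfun X) = idfun ;
  fmap_comp : forall (X Y Z : SET) (g : Y -> Z) (f : X -> Y),
    fmap (g \o f) = fmap g \o fmap f
}.

Arguments fmap F {X Y} f : rename.

Record lax_extension d (V : quantaleType d) (F : set_functor) := LaxExtension {
  lax :> forall X Y : SET, vrel V X Y -> vrel V (F X) (F Y) ;
  lax_mono : forall (X Y : SET) (r r' : vrel V X Y),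
    vrel_le r r' -> vrel_le (lax r) (lax r') ;
  lax_comp : forall (X Y Z : SET) (s : vrel V Y Z) (r : vrel V X Y),
    vrel_le (vrel_comp (lax s) (lax r)) (lax (vrel_comp s r)) ;
  lax_graph : forall (X Y : SET) (f : X -> Y),
    vrel_le (vrel_graph V (fmap F f)) (lax (vrel_graph V f)) ;
  lax_graph_conv : forall (X Y : SET) (f : X -> Y),
    vrel_le (vrel_conv (vrel_graph V (fmap F f)))
            (lax (vrel_conv (vrel_graph V f)))
}.

Arguments lax {d V F} L {X Y} r : rename.

Section LaxVCategory.
Context {d : Order.disp_t} {V : quantaleType d} {F : set_functor}.
Variables (L : lax_extension V F) (X : SET).

Lemma lax_vcat_refl : vrel_le (vrel_id V (F X)) (lax L (vrel_id V X)).
Proof. by have := lax_graph L (@idfun X); rewrite fmap_id. Qed.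

Lemma vrel_id_idem :
  vrel_le (vrel_comp (vrel_id V X) (vrel_id V X)) (vrel_id V X).
Proof.
move=> x z; apply: qsup_le => _ [y _ <-]; rewrite /vrel_id.
case: (asboolP (x = y)) => [->|_]; first by rewrite qtens1l.
rewrite qtensC /qbot qtens_sup image_set0; exact: qbot_le.
Qed.

Lemma lax_vcat_trans :
  vrel_le (vrel_comp (lax L (vrel_id V X)) (lax L (vrel_id V X)))
          (lax L (vrel_id V X)).
Proof.
move=> x z; apply: le_trans (lax_comp L _ _ x z) _.
exact: lax_mono vrel_id_idem _ _.
Qed.

Definition lax_vcat : vcategory V := VCategory lax_vcat_refl lax_vcat_trans.

End LaxVCategory.

Definition vpow d (V : quantaleType d) (K : SET) : SET := K -> V.

(* Cardinals are represented by sets: the arity of a lifting is a set K,      *)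
(* standing for its cardinality.                                              *)
Record predicate_lifting d (V : quantaleType d) (F : set_functor) (K : SET) :=
  PredicateLifting {
    plift :> forall X : SET, (X -> vpow V K) -> (F X -> V) ;
    plift_nat : forall (X Y : SET) (f : X -> Y) (g : Y -> vpow V K),
      plift (g \o f) = plift g \o fmap F f
  }.

Arguments plift {d V F K} m {X} g : rename.

Definition monotone_lifting d (V : quantaleType d) (F : set_functor) (K : SET)
    (m : predicate_lifting V F K) : Prop :=
  forall (X : SET) (g h : X -> vpow V K),
    (forall x i, g x i <= h x i) -> forall t : F X, plift m g t <= plift m h t.

Definition lifting_class d (V : quantaleType d) (F : set_functor) :=
  forall K : SET, predicate_lifting V F K -> Prop.

Definition lifting_bar d (V : quantaleType d) (F : set_functor) (K : SET)
    (m : predicate_lifting V F K) (X : SET) : F X -> ((X -> vpow V K) -> V) :=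
  fun t g => plift m g t.

Definition separating_class d (V : quantaleType d) (F : set_functor)
    (M : lifting_class V F) : Prop :=
  forall (X : SET) (t u : F X),
    (forall (K : SET) (m : predicate_lifting V F K), M K m ->
       lifting_bar m t = lifting_bar m u) -> t = u.

Definition monotone_class d (V : quantaleType d) (F : set_functor)
    (M : lifting_class V F) : Prop :=
  forall (K : SET) (m : predicate_lifting V F K), M K m -> monotone_lifting m.

(* Main.v *)
Require Import Defs.
From mathcomp Require Import all_boot all_order.
From mathcomp Require Import boolp classical_sets.

(** Both directions are explicit constructions relating a lax extension to the
    predicate liftings that are compatible with it.

    From liftings to a lax extension: a class [M] of monotone liftings
    induces the Kantorovich extension, the largest assignment such that every
    lifting in [M], applied to an arbitrary predicate, can be transported along
    a relation.  Its value at [(t, u)] is the largest [w] such that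
    [m(g)(t) * w <= m(r.g)(u)] for all [m] in [M] and all [g] ([kantorovichP]).
    With this characterization, monotonicity of the extension is monotonicity of
    the liftings, compatibility with functions follows from their naturality and
    monotonicity, and lax functoriality comes from [s.(r.g) <= (s.r).g].  At [r = 1_X] the
    inequality [k <= w] unfolds to [m(g)(t) <= m(g)(u)], so that equivalent
    points of [F X] are identified by all liftings, hence equal.

    From a lax extension to liftings: each point [c] of [F K] induces a
    monotone [K]-ary lifting, whose value on a predicate [g], read as a
    relation from [K] to [X], is the relation obtained by extending [g] and
    fixing its first argument to [c] ([moss_lifting]).  Naturality is the
    identity [L(f^o . r) = (Ff)^o . L r] ([lax_pullback]).  The lifting induced
    by a point [t] of [F X] itself, evaluated at the identity relation, is the
    hom [L 1_X (t, -)] of the category [F X]; since it is at least [k] at [t],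
    two points with the same values under all liftings are equivalent in this
    category, hence equal when it is separated. *)

Set Implicit Arguments.
Unset Strict Implicit.
Unset Printing Implicit Defensive.

Import Order.TTheory.

Local Open Scope classical_set_scope.
Local Open Scope order_scope.

Section QuantaleTheory.
Context {d : Order.disp_t} {V : quantaleType d}.
Implicit Types (u v w : V) (A : set V).

Lemma qtens1r v : qtens v qunit = v.
Proof. by rewrite qtensC qtens1l. Qed.

(** Monotonicity is preservation of the supremum of the pair [v <= w]. *)
Lemma qtens_le2l u v w : v <= w -> qtens u v <= qtens u w.
Proof.
move=> vw; suff <- : qsup [set v; w] = w.
  by rewrite qtens_sup; apply: qsup_ub; exists v => //; left.
apply/le_anti/andP; split; last by apply: qsup_ub; right.
by apply: qsup_le => _ [->|->].
Qed.

Lemma qtens_le2r u v w : v <= w -> qtens v u <= qtens w u.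
Proof. by move=> vw; rewrite !(qtensC _ u); exact: qtens_le2l. Qed.

Lemma qtens_sup_le u A w :
  (forall v, A v -> qtens u v <= w) -> qtens u (qsup A) <= w.
Proof.
by move=> Aw; rewrite qtens_sup; apply: qsup_le => _ [v Av <-]; exact: Aw.
Qed.

Lemma vrel_comp_ub (X Y Z : SET) (s : vrel V Y Z) (r : vrel V X Y) x y z :
  qtens (r x y) (s y z) <= vrel_comp s r x z.
Proof. by apply: qsup_ub; exists y. Qed.

Lemma vrel_comp_le (X Y Z : SET) (s : vrel V Y Z) (r : vrel V X Y) x z w :
  (forall y, qtens (r x y) (s y z) <= w) -> vrel_comp s r x z <= w.
Proof. by move=> rsw; apply: qsup_le => _ [y _ <-]. Qed.

Lemma vrel_comp_mono (X Y Z : SET) (s s' : vrel V Y Z) (r : vrel V X Y) :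
  vrel_le s s' -> vrel_le (vrel_comp s r) (vrel_comp s' r).
Proof.
move=> ss x z; apply: vrel_comp_le => y.
by apply: le_trans (vrel_comp_ub _ _ _ y _); exact: qtens_le2l.
Qed.

Lemma vrel_comp_assoc_le (X Y Z W : SET)
    (t : vrel V Z W) (s : vrel V Y Z) (r : vrel V X Y) :
  vrel_le (vrel_comp t (vrel_comp s r)) (vrel_comp (vrel_comp t s) r).
Proof.
move=> x w; apply: vrel_comp_le => z.
rewrite qtensC; apply: qtens_sup_le => _ [y _ <-].
rewrite qtensC -qtensA; apply: le_trans (vrel_comp_ub _ _ _ y _).
exact/qtens_le2l/vrel_comp_ub.
Qed.

Lemma vrel_graphE (X Y : SET) (f : X -> Y) x : vrel_graph V f x (f x) = qunit.
Proof. by rewrite /vrel_graph asboolT. Qed.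

(** Off the graph the right-hand factor is bottom, which is absorbing as the
    empty supremum. *)
Lemma qtens_graph_le (X Y : SET) (f : X -> Y) x y v w :
  (f x = y -> v <= w) -> qtens v (vrel_graph V f x y) <= w.
Proof.
rewrite /vrel_graph; case: asboolP => [fxy /(_ fxy)|_ _].
  by rewrite qtens1r.
exact: qtens_sup_le.
Qed.

End QuantaleTheory.

(** * The Kantorovich extension of a class of monotone liftings *)

Section Kantorovich.
Context {d : Order.disp_t} {V : quantaleType d} {F : set_functor}.

(** The composite [r . g], where the [V^K]-valued predicate [g] on [X] is read
    as a relation from [K] to [X]. *)
Definition pred_image (X Y K : SET) (r : vrel V X Y) (g : X -> vpow V K) :
    Y -> vpow V K :=
  vrel_conv (vrel_comp r (vrel_conv g)).

Variable M : lifting_class V F.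

Definition transports (X Y : SET) (r : vrel V X Y) (t : F X) (u : F Y) (w : V) :=
  forall (K : SET) (m : predicate_lifting V F K), M m ->
  forall g : X -> vpow V K, qtens (plift m g t) w <= plift m (pred_image r g) u.

(** In terms of the residuation of the quantale this is the usual meet of the
    homs from [m(g)(t)] to [m(r.g)(u)]. *)
Definition kantorovich (X Y : SET) (r : vrel V X Y) : vrel V (F X) (F Y) :=
  fun t u => qsup [set w | transports r t u w].

(** The supremum is attained because tensoring preserves suprema. *)
Lemma kantorovichP (X Y : SET) (r : vrel V X Y) t u w :
  w <= kantorovich r t u <-> transports r t u w.
Proof.
split=> [wr K m Mm g|]; last exact: qsup_ub.
apply: le_trans (qtens_le2l _ wr) _.
by apply: qtens_sup_le => v; apply.
Qed.

Hypothesis M_mono : monotone_class M.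

Lemma kantorovich_mono (X Y : SET) (r r' : vrel V X Y) :
  vrel_le r r' -> vrel_le (kantorovich r) (kantorovich r').
Proof.
move=> rr' t u; apply/kantorovichP => K m Mm g.
move/kantorovichP: (lexx (kantorovich r t u)) => /(_ K m Mm g) /le_trans.
by apply; apply: M_mono => // y i; exact: vrel_comp_mono.
Qed.

Lemma kantorovich_comp (X Y Z : SET) (s : vrel V Y Z) (r : vrel V X Y) :
  vrel_le (vrel_comp (kantorovich s) (kantorovich r))
          (kantorovich (vrel_comp s r)).
Proof.
move=> t v; apply: vrel_comp_le => u; apply/kantorovichP => K m Mm g.
move/kantorovichP: (lexx (kantorovich r t u)) => /(_ K m Mm g) rP.
move/kantorovichP: (lexx (kantorovich s u v)).
move=> /(_ K m Mm (pred_image r g)) sP.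
rewrite qtensA; apply: le_trans (qtens_le2r _ rP) _; apply: le_trans sP _.
by apply: M_mono => // z i; exact: vrel_comp_assoc_le.
Qed.

(** By naturality the claim for [F f] reduces to [g <= (f . g) \o f]. *)
Lemma kantorovich_graph (X Y : SET) (f : X -> Y) :
  vrel_le (vrel_graph V (fmap F f)) (kantorovich (vrel_graph V f)).
Proof.
move=> t u; apply/kantorovichP => K m Mm g; apply: qtens_graph_le => <-.
have -> : plift m (pred_image (vrel_graph V f) g) (fmap F f t) =
          plift m (pred_image (vrel_graph V f) g \o f) t by rewrite plift_nat.
apply: M_mono => // x i; rewrite -[leLHS]qtens1r -(vrel_graphE f x).
exact: (vrel_comp_ub _ (vrel_conv g)).
Qed.

(** By naturality the claim for [(F f)^o] reduces to [g \o f <= f^o . g]. *)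
Lemma kantorovich_graph_conv (X Y : SET) (f : X -> Y) :
  vrel_le (vrel_conv (vrel_graph V (fmap F f)))
          (kantorovich (vrel_conv (vrel_graph V f))).
Proof.
move=> u t; apply/kantorovichP => K m Mm g; apply: qtens_graph_le => <-.
have -> : plift m g (fmap F f t) = plift m (g \o f) t by rewrite plift_nat.
apply: M_mono => // x i; rewrite -[leLHS]qtens1r -(vrel_graphE f x).
exact: (vrel_comp_ub (vrel_conv (vrel_graph V f)) (vrel_conv g)).
Qed.

Definition kantorovich_extension : lax_extension V F :=
  LaxExtension kantorovich_mono kantorovich_comp
               kantorovich_graph kantorovich_graph_conv.

Lemma kantorovich_id_le (X : SET) (t u : F X) :
  qunit <= kantorovich (vrel_id V X) t u ->
  forall (K : SET) (m : predicate_lifting V F K), M m ->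
  forall g : X -> vpow V K, plift m g t <= plift m g u.
Proof.
move=> /kantorovichP tu K m Mm g.
have := tu K m Mm g; rewrite qtens1r => /le_trans; apply.
apply: M_mono => // x i; apply: vrel_comp_le => y.
by apply: (qtens_graph_le (f := idfun)) => <-.
Qed.

Lemma kantorovich_separated : separating_class M ->
  forall X : SET, separated_vcat (lax_vcat kantorovich_extension X).
Proof.
move=> M_sep X t u tu ut; apply: M_sep => K m Mm; apply/funext => g.
by apply/le_anti/andP; split; exact: kantorovich_id_le.
Qed.

End Kantorovich.

(** * The liftings induced by a lax extension *)

Section Moss.
Context {d : Order.disp_t} {V : quantaleType d} {F : set_functor}.
Variable L : lax_extension V F.

(** The relation [fun i x => r i (f x)] is [f^o . r].  One inequality of
    [L(f^o . r) = (Ff)^o . L r] composes with [L f >= F f] and uses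
    [f . f^o <= 1]; the other composes with [L(f^o) >= (F f)^o]. *)
Lemma lax_pullback (K X Y : SET) (r : vrel V K Y) (f : X -> Y) c t :
  lax L (fun i x => r i (f x)) c t = lax L r c (fmap F f t).
Proof.
apply/le_anti/andP; split; rewrite -[leLHS]qtens1r.
- have := lax_graph L f t (fmap F f t); rewrite vrel_graphE => kf.
  apply: le_trans (qtens_le2l _ kf) _.
  apply: le_trans (vrel_comp_ub _ _ _ _ _) _.
  apply: le_trans (lax_comp _ _ _ _ _) _; apply: lax_mono => i y.
  by apply: vrel_comp_le => x; apply: qtens_graph_le => <-.
- have := lax_graph_conv L f (fmap F f t) t.
  rewrite {1}/vrel_conv vrel_graphE => kf.
  apply: le_trans (qtens_le2l _ kf) _.
  apply: le_trans (vrel_comp_ub _ _ _ _ _) _.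
  apply: le_trans (lax_comp _ _ _ _ _) _; apply: lax_mono => i x.
  by apply: vrel_comp_le => y; apply: qtens_graph_le => <-.
Qed.

Section Lifting.
Variables (K : SET) (c : F K).

Definition moss (X : SET) (g : X -> vpow V K) : F X -> V :=
  lax L (vrel_conv g) c.

Lemma moss_nat (X Y : SET) (f : X -> Y) (g : Y -> vpow V K) :
  moss (g \o f) = moss g \o fmap F f.
Proof. by apply/funext => t; exact: (lax_pullback (vrel_conv g)). Qed.

Definition moss_lifting : predicate_lifting V F K := PredicateLifting moss_nat.

Lemma moss_lifting_monotone : monotone_lifting moss_lifting.
Proof. by move=> X g h gh t; apply: lax_mono => i x; exact: gh. Qed.

End Lifting.

(** At the identity relation, the lifting induced by [t] is the hom out of [t]
    in the category [F X], which is at least [k] at [t] by reflexivity. *)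
Lemma moss_lifting_id_le (X : SET) (t u : F X) :
  lifting_bar (moss_lifting t) t = lifting_bar (moss_lifting t) u ->
  qunit <= lax L (vrel_id V X) t u.
Proof.
move=> /(congr1 (fun h => h (vrel_conv (vrel_id V X)))) tu.
have <- : lax L (vrel_id V X) t t = lax L (vrel_id V X) t u by exact: tu.
by have := lax_vcat_refl L t t; rewrite {1}/vrel_id asboolT.
Qed.

Lemma monotone_liftings_separating :
  (forall X : SET, separated_vcat (lax_vcat L X)) ->
  separating_class (@monotone_lifting d V F).
Proof.
move=> L_sep X t u tu; apply: (L_sep X).
- by apply: moss_lifting_id_le; apply/tu/moss_lifting_monotone.
- by apply: moss_lifting_id_le; apply/esym/tu/moss_lifting_monotone.
Qed.

End Moss.

Theorem corollary4p21 (d : Order.disp_t) (V : quantaleType d) (F : set_functor) :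
  (exists M : lifting_class V F, monotone_class M /\ separating_class M) <->
  (exists L : lax_extension V F, forall X : SET, separated_vcat (lax_vcat L X)).
Proof.
split=> [[M [M_mono M_sep]]|[L L_sep]].
- by exists (kantorovich_extension M_mono); exact: kantorovich_separated.
- exists (@monotone_lifting d V F); split=> //.
  exact: (monotone_liftings_separating L_sep).
Qed.
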